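(* Let $\{p_n\}_{n\geq 1}$ be the sequence of ordinary prime numbers and let $N\geq 1$ be an integer. Then for (Lebesgue-)almost every choice $(q_1,\dots,q_N)\in(1,\infty)^N$, the set $q=\{p_n\}_{n\geq1}\cup\{q_j\}_{j=1}^N$ is a system of Beurling primes and the Beurling integers $\{\nu_n\}_{n\geq1}$ generated by $q$ satisfy Bohr's condition: there exist $c_1,c_2>0$ such that $$\nu_{n+1}-\nu_n\geq c_1\,\nu_{n+1}^{-c_2},\qquad n\in\mathbb{N}.$$
   Context: A system of Beurling primes is an increasing sequence (finite or infinite) $q=\{q_n\}$ of real numbers with $q_n>1$ (and $q_n\to\infty$ if infinite) such that $\{\log q_n\}$ is linearly independent over $\mathbb{Q}$. The Beurling integers $\mathbb{N}_q=\{\nu_n\}_{n\geq1}$ are all numbers that can be written as finite products of elements of $q$ (including the empty product $\nu_1=1$), listed in increasing order; by linear independence each has a unique such representation. *)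

(* Defs.v *)
From HB Require Import structures.
From mathcomp Require Import all_boot all_order all_algebra.
From mathcomp Require Import all_classical all_reals all_analysis.
Set Implicit Arguments. Unset Strict Implicit. Unset Printing Implicit Defensive.
Import Order.TTheory GRing.Theory Num.Theory.
Local Open Scope ring_scope.
Local Open Scope classical_set_scope.

Section Beurling.
Variables (R : realType) (N : nat).

(* {log p : p prime} together with {log q_j : j < N} is a linearly
   independent family over Q (indexed family: coincidences are dependences). *)
Definition lin_indep_logs (q : 'I_N -> R) : Prop :=
  forall (M : nat) (a : nat -> rat) (b : 'I_N -> rat),
    \sum_(p < M | prime p) ratr (a p) * ln (p%:R : R)
      + \sum_(j < N) ratr (b j) * ln (q j) = 0 ->
    (forall p : nat, (p < M)%N -> prime p -> a p = 0) /\ (forall j, b j = 0).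

Definition beurling_system (q : 'I_N -> R) : Prop :=
  (forall j, 1 < q j) /\ lin_indep_logs q.

Definition beurling_int (q : 'I_N -> R) (x : R) : Prop :=
  exists (M : nat) (e : nat -> nat) (f : 'I_N -> nat),
    x = (\prod_(p < M | prime p) (p%:R : R) ^+ e p) * \prod_(j < N) q j ^+ f j.

(* Bohr's condition for the increasingly enumerated Beurling integers
   nu_0 < nu_1 < ... (indexing from 0 here) *)
Definition bohr_condition (q : 'I_N -> R) : Prop :=
  exists c1 c2 : R, 0 < c1 /\ 0 < c2 /\
    exists nu : nat -> R,
      (forall n, nu n < nu n.+1) /\
      (forall x, beurling_int q x <-> exists n, nu n = x) /\
      (forall n, nu n.+1 - nu n >= c1 * nu n.+1 `^ (- c2)).

Definition lebesgue_null (E : set ('I_N -> R)) : Prop :=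
  forall eps : R, 0 < eps ->
    exists a b : nat -> 'I_N -> R,
      (forall k j, a k j <= b k j) /\
      (forall x, E x -> exists k, forall j, a k j <= x j <= b k j) /\
      (forall K, \sum_(k < K) \prod_(j < N) (b k j - a k j) <= eps).

End Beurling.

(* Main.v *)
(** Taking logarithms, two products [m q^f] and [m' q^f'] with [f_j <> f'_j]
    that lie within [h] of each other force [log q_j] into an interval of
    length [O(h)] once the other coordinates are given, so for bounded [q] this
    event has measure [O(h)].  If moreover [q_j >= 1 + 1/(k+1)] for all [j],
    only polynomially many (in [X]) pairs of products are at most [X]; taking
    [h = c X^-C] with [C] large and [X = 2^i], the measures sum over [i] to
    [O(c)], hence almost every [q] has all such gaps at least [c X^-C] for some
    [c > 0].  Products with the same [f] differ by at least 1.  This separation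
    gives Bohr's condition, and a rational dependence between the logarithms
    would produce two equal products with distinct [f], or else contradict
    unique factorization in the integers. *)

Require Import Defs.
From HB Require Import structures.
From mathcomp Require Import all_boot all_order all_algebra.
From mathcomp Require Import all_classical all_reals all_analysis.
From mathcomp Require Import ring lra zify.
Import Order.TTheory GRing.Theory Num.Theory.
Local Open Scope ring_scope.
Local Open Scope classical_set_scope.

(** * Covers by countably many boxes of bounded total volume *)

(** A quantitative form of nullity: [lebesgue_null E] amounts to [covered E e] for every [e > 0],
    and explicit values of [e] can be added over unions. *)
Definition covered {R : realType} {N : nat} (E : set ('I_N -> R)) (e : R) :=
  exists a b : nat -> 'I_N -> R,
    [/\ forall k j, a k j <= b k j,
        forall x, E x -> exists k, forall j, a k j <= x j <= b k j &
        forall K, \sum_(k < K) \prod_(j < N) (b k j - a k j) <= e].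

Lemma sum_uniq_sub_le {R : numDomainType} {I : eqType} (s t : seq I)
    (F : I -> R) :
  (forall i, 0 <= F i) -> uniq s -> {subset s <= t} ->
  \sum_(i <- s) F i <= \sum_(i <- t) F i.
Proof.
move=> F0 us st.
have pt : perm_eq (undup t) (s ++ [seq i <- undup t | i \notin s]).
  apply: uniq_perm; first exact: undup_uniq.
    rewrite cat_uniq us filter_uniq ?undup_uniq // andbT /=.
    by apply/hasPn => i; rewrite mem_filter => /andP[].
  move=> i; rewrite mem_cat mem_filter mem_undup.
  by case: (boolP (i \in s)) => //= /st ->.
apply: (@le_trans _ _ (\sum_(i <- undup t) F i)).
  by rewrite (perm_big _ pt) big_cat lerDl sumr_ge0.
elim: t {st pt} => //= i t ih; case: ifP => _; rewrite !big_cons.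
  by rewrite (le_trans ih) // lerDr.
by rewrite lerD2l.
Qed.

Lemma sum_uniq_le {R : numDomainType} {I : finType} (s : seq I) (F : I -> R) :
  (forall i, 0 <= F i) -> uniq s -> \sum_(i <- s) F i <= \sum_i F i.
Proof.
by move=> F0 us; apply: sum_uniq_sub_le => // i _; rewrite mem_index_enum.
Qed.

Lemma sum_uniq_half_le {R : realFieldType} (s : seq nat) (e : R) :
  0 <= e -> uniq s -> \sum_(i <- s) e / 2 ^+ i.+1 <= e.
Proof.
move=> e0 us.
have F0 (i : nat) : 0 <= e / 2 ^+ i.+1 by rewrite divr_ge0 ?exprn_ge0.
have [M sM] : exists M, {subset s <= index_iota 0 M}.
  exists (\max_(i <- s) i).+1 => i si; rewrite mem_index_iota /= ltnS.
  exact: leq_bigmax_seq.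
apply: le_trans (sum_uniq_sub_le _ _ (fun i : nat => e / 2 ^+ i.+1) F0 us sM) _.
have -> : \sum_(0 <= i < M) e / 2 ^+ i.+1 = e - e / 2 ^+ M.
  elim: M {sM} => [|M ih]; first by rewrite big_geq // expr0 divr1 subrr.
  rewrite big_nat_recr //= ih exprS; field.
  by rewrite expf_neq0 ?pnatr_eq0.
by rewrite gerBl divr_ge0 ?exprn_ge0.
Qed.

Lemma covered_sub {R : realType} {N : nat} (E F : set ('I_N -> R)) (e f : R) :
  E `<=` F -> f <= e -> covered F f -> covered E e.
Proof.
move=> EF fe [a [b [ab Fab vab]]]; exists a, b; split=> // [x /EF/Fab//|K].
exact: le_trans (vab K) fe.
Qed.

(** The boxes of all the covers are listed in one sequence through a code of the pairs (set, box).
    Any finite part of that sequence lies in a finite rectangle of pairs, where the volumes can be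
    summed set by set. *)
Lemma covered_bigcup {R : realType} {n : nat} {I : countType}
    (F : I -> set ('I_n.+1 -> R)) (v : I -> R) (e : R) :
  (forall i, covered (F i) (v i)) ->
  (forall s : seq I, uniq s -> \sum_(i <- s) v i <= e) ->
  covered (\bigcup_i F i) e.
Proof.
move=> /choice[a /choice[b ab]] ve.
have iotaE K : iota 0 K = index_iota 0 K by rewrite /index_iota subn0.
pose vol (il : I * nat) := \prod_j (b il.1 il.2 j - a il.1 il.2 j).
have vol0 il : 0 <= vol il.
  by apply: prodr_ge0 => j _; rewrite subr_ge0; case: (ab il.1).
(* Numbers that code no pair get a one-point box. Its volume is 0 because the dimension [n.+1] is
   positive; in dimension 0 the empty product would be 1. *)
pose box (c : I -> nat -> 'I_n.+1 -> R) (k : nat) : 'I_n.+1 -> R :=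
  if (pickle_inv k : option (I * nat)) is Some il then c il.1 il.2 else fun=> 0.
exists (box a), (box b); split=> [k j|x [i _ Fx]|K].
- by rewrite /box; case: pickle_inv => // -[i l]; case: (ab i).
- have [_ /(_ x Fx)[l xl] _] := ab i.
  by exists (pickle (i, l)) => j; rewrite /box pickleK_inv.
- pose s := pmap (@pickle_inv (I * nat)%type) (iota 0 K).
  have us : uniq s by apply: pmap_uniq (iota_uniq 0 K); exact: pickle_invK.
  have -> : \sum_(k < K) \prod_j (box b k j - box a k j) =
            \sum_(il <- s) vol il.
    rewrite big_pmap iotaE big_mkord.
    apply: eq_bigr => k _; rewrite /box; case: pickle_inv => //=.
    by rewrite big_ord_recl subrr mul0r.
  pose s1 := undup (map fst s).
  pose M := (\max_(il <- s) il.2).+1.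
  apply: (@le_trans _ _ (\sum_(il <- [seq (i, l) | i <- s1, l <- iota 0 M]) vol il)).
    apply: sum_uniq_sub_le => // -[i l] sil; apply: allpairs_f.
      by rewrite mem_undup; apply/mapP; exists (i, l).
    by rewrite mem_iota /= ltnS; exact: (@leq_bigmax_seq _ s predT snd (i, l)).
  rewrite big_allpairs; apply: le_trans (ve s1 (undup_uniq _)).
  apply: ler_sum => i _; rewrite iotaE big_mkord.
  by case: (ab i) => _ _; exact.
Qed.

Lemma covered_finType {R : realType} {n : nat} {I : finType}
    (F : I -> set ('I_n.+1 -> R)) (v : R) :
  0 <= v -> (forall i, covered (F i) v) -> covered (\bigcup_i F i) (v *+ #|I|).
Proof.
move=> v0 Fv; apply: covered_bigcup Fv _ => s us.
by rewrite -sumr_const; exact: sum_uniq_le.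
Qed.

Lemma covered_seq {R : realType} {n : nat} (F : nat -> set ('I_n.+1 -> R))
    (e : R) :
  0 <= e -> (forall k, covered (F k) (e / 2 ^+ k.+1)) ->
  covered (\bigcup_k F k) e.
Proof.
by move=> e0 Fe; apply: covered_bigcup Fe _ => s; exact: sum_uniq_half_le.
Qed.

Lemma covered_box {R : realType} {n : nat} (a b : 'I_n.+1 -> R) :
  (forall j, a j <= b j) ->
  covered [set x | forall j, a j <= x j <= b j] (\prod_j (b j - a j)).
Proof.
move=> ab; exists (fun k => if k is 0%N then a else fun=> 0),
  (fun k => if k is 0%N then b else fun=> 0); split=> [[]//|x xab|K].
  by exists 0%N.
case: K => [|K]; first by rewrite big_ord0 prodr_ge0 // => j _; rewrite subr_ge0.
rewrite big_ord_recl [X in _ + X]big1 ?addr0 // => k _.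
by rewrite big_ord_recl subrr mul0r.
Qed.

Lemma covered_set0 (R : realType) (n : nat) :
  covered (set0 : set ('I_n.+1 -> R)) 0.
Proof.
apply: covered_sub (covered_box (fun=> 0) (fun=> 0) (fun=> lexx _)) => //.
by rewrite big_ord_recl subrr mul0r.
Qed.

(** * Logarithmic estimates and the volume of a near-coincidence slab *)

(* [m] is the part of a Beurling integer composed of ordinary primes. *)
Definition bval {R : realType} {N : nat} (q : 'I_N -> R) (m : nat)
  (f : 'I_N -> nat) : R := m%:R * \prod_j q j ^+ f j.

Lemma ln_prod {R : realType} {I : Type} (r : seq I) (P : pred I) (F : I -> R) :
  (forall i, P i -> 0 < F i) ->
  ln (\prod_(i <- r | P i) F i) = \sum_(i <- r | P i) ln (F i).
Proof.
move=> F0.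
suff [] : 0 < \prod_(i <- r | P i) F i /\
  ln (\prod_(i <- r | P i) F i) = \sum_(i <- r | P i) ln (F i) by [].
elim/big_rec2: _ => [|i y x /F0 Fi [x0 <-]]; first by rewrite ltr01 ln1.
by rewrite mulr_gt0 // lnM.
Qed.

Lemma ln_bval {R : realType} {N : nat} (q : 'I_N -> R) (m : nat)
    (f : 'I_N -> nat) :
  (forall j, 0 < q j) -> (0 < m)%N ->
  ln (bval q m f) = ln m%:R + \sum_j (f j)%:R * ln (q j).
Proof.
move=> q0 m0; rewrite lnM ?posrE ?ltr0n ?prodr_gt0 //; last first.
  by move=> j _; rewrite exprn_gt0.
congr (_ + _); rewrite ln_prod => [|j _]; last by rewrite exprn_gt0.
by apply: eq_bigr => j _; rewrite lnXn // mulr_natl.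
Qed.

Lemma bval_ge1 {R : realType} {N : nat} (q : 'I_N -> R) (m : nat)
    (f : 'I_N -> nat) :
  (forall j, 1 <= q j) -> (0 < m)%N -> 1 <= bval q m f.
Proof.
move=> q1 m0; rewrite -[1]mulr1 ler_pM ?ler1n //.
by elim/big_ind: _ => // [x y x1 y1|j _]; rewrite ?exprn_ege1 // mulr_ege1.
Qed.

Lemma ln_sub_le {R : realType} (x y : R) :
  0 < x -> 0 < y -> ln x - ln y <= (x - y) / y.
Proof.
move=> x0 y0; rewrite -ln_div ?posrE //.
have -> : x / y = 1 + (x - y) / y by field; rewrite gt_eqF.
apply: le_ln1Dx; rewrite ltr_pdivlMr //; lra.
Qed.

Lemma dist_ln_le {R : realType} (x y : R) :
  1 <= x -> 1 <= y -> `|ln x - ln y| <= `|x - y|.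
Proof.
wlog xy : x y / y <= x.
  move=> H x1 y1; case: (leP y x) => [|/ltW] xy; first exact: H.
  by rewrite distrC [leRHS]distrC H.
move=> x1 y1; have [x0 y0] : 0 < x /\ 0 < y by split; lra.
rewrite !ger0_norm ?subr_ge0 ?ler_ln //.
apply: le_trans (ln_sub_le _ _ x0 y0) _.
by rewrite ler_pdivrMr // ler_peMr // subr_ge0.
Qed.

(** [ln] has slope at least [1 / B] on [(0, B]]; this carries a bound on logarithms back to the
    coordinate itself. *)
Lemma dist_le_ln {R : realType} (B x y : R) :
  0 < x <= B -> 0 < y <= B -> `|x - y| <= B * `|ln x - ln y|.
Proof.
wlog xy : x y / y <= x.
  move=> H x1 y1; case: (leP y x) => [|/ltW] xy; first exact: H.
  by rewrite distrC [X in _ * X]distrC H.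
move=> /andP[x0 xB] /andP[y0 yB].
rewrite !ger0_norm ?subr_ge0 ?ler_ln //.
have := ln_sub_le _ _ y0 x0; rewrite ler_pdivlMr // => h.
have l0 : 0 <= ln x - ln y by rewrite subr_ge0 ler_ln.
nra.
Qed.

(** At both points the same affine form in the [ln (q i)], with integer coefficients [f i - f' i],
    is at most [h] in absolute value. Subtracting removes the constant, and the terms [i != j] are
    controlled by [d]. *)
Lemma bval_coord_dist_le {R : realType} {N : nat} (q q' : 'I_N -> R)
    (j : 'I_N) (m m' : nat) (f f' : 'I_N -> nat) (h d : R) :
  (0 < m)%N -> (0 < m')%N -> f j != f' j ->
  (forall i, 1 <= q i) -> (forall i, 1 <= q' i) ->
  `|bval q m f - bval q m' f'| <= h -> `|bval q' m f - bval q' m' f'| <= h ->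
  0 <= d -> (forall i, i != j -> `|q i - q' i| <= d) ->
  `|ln (q j) - ln (q' j)| <= 2 * h + (\sum_i `|(f i)%:R - (f' i)%:R|) * d.
Proof.
move=> m0 m'0 fj q1 q'1 hq hq' d0 dq.
have pos (p : 'I_N -> R) : (forall i, 1 <= p i) -> forall i, 0 < p i.
  by move=> p1 i; apply: lt_le_trans (p1 i).
pose g i : R := (f i)%:R - (f' i)%:R.
have slab p : (forall i, 1 <= p i) -> `|bval p m f - bval p m' f'| <= h ->
    `|ln m%:R - ln m'%:R + \sum_i g i * ln (p i)| <= h.
  move=> p1; apply: le_trans.
  rewrite (le_trans _ (dist_ln_le _ _ (bval_ge1 _ _ _ p1 m0) (bval_ge1 _ _ _ p1 m'0))) //.
  rewrite !ln_bval //; try exact: pos.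
  rewrite le_eqVlt; apply/orP; left; apply/eqP; congr `|_|.
  rewrite (eq_bigr (fun i => (f i)%:R * ln (p i) - (f' i)%:R * ln (p i))).
    by rewrite sumrB; ring.
  by move=> i _; rewrite /g mulrBl.
have hD : `|\sum_i g i * (ln (q i) - ln (q' i))| <= 2 * h.
  have -> : \sum_i g i * (ln (q i) - ln (q' i)) =
     (ln m%:R - ln m'%:R + \sum_i g i * ln (q i)) -
     (ln m%:R - ln m'%:R + \sum_i g i * ln (q' i)).
    rewrite (eq_bigr (fun i => g i * ln (q i) - g i * ln (q' i))).
      by rewrite sumrB; ring.
    by move=> i _; rewrite mulrBr.
  apply: le_trans (ler_normB _ _) _.
  by rewrite mulr_natl mulr2n lerD ?slab.
have gj : 1 <= `|g j|.
  rewrite ler_normr /g.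
  case: (ltngtP (f j) (f' j)) fj => // ff _; move: ff;
    rewrite -(ler_nat R) -natr1; lra.
apply: (@le_trans _ _ (`|g j * (ln (q j) - ln (q' j))|)).
  by rewrite normrM ler_peMl.
rewrite (bigD1 j) //= in hD.
have -> : g j * (ln (q j) - ln (q' j)) =
   (g j * (ln (q j) - ln (q' j)) +
     \sum_(i | i != j) g i * (ln (q i) - ln (q' i))) -
   \sum_(i | i != j) g i * (ln (q i) - ln (q' i)) by ring.
apply: le_trans (ler_normB _ _) _; apply: lerD => //.
apply: le_trans (ler_norm_sum _ _ _) _.
rewrite mulr_suml [leRHS](bigD1 j) //= -[leLHS]add0r.
apply: lerD; first by rewrite mulr_ge0.
apply: ler_sum => i ij; rewrite normrM ler_wpM2l //.
by apply: le_trans (dq i ij); exact: dist_ln_le.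
Qed.

(** Fubini by hand: the coordinates other than [j] are cut into [(B * D) ^ n] cells of side [1 / D],
    and over each cell coordinate [j] stays in an interval of length [2 * w]. The powers of [D]
    cancel, so the bound is independent of the exponents. *)
Lemma covered_slab {R : realType} {n : nat} (B : nat) (h : R) (j : 'I_n.+1)
    (m m' : nat) (f f' : 'I_n.+1 -> nat) :
  (0 < B)%N -> 0 < h -> (0 < m)%N -> (0 < m')%N -> f j != f' j ->
  covered [set q : 'I_n.+1 -> R | (forall i, 1 <= q i <= B%:R) /\
                           `|bval q m f - bval q m' f'| <= h]
    (6 * h * B%:R ^+ n.+1).
Proof.
move=> B0 h0 m0 m'0 fj; set S := [set q | _].
pose L : R := \sum_i `|(f i)%:R - (f' i)%:R|.
have L0 : 0 <= L by apply: sumr_ge0.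
(* The mesh is fine enough for the other coordinates to add at most [h] to the [2 * h] of
   [bval_coord_dist_le]; hence the [3 * h] in [w], whose factor [B] comes from [dist_le_ln]. *)
have [D D0 LD] : exists2 D : nat, (0 < D)%N & L / D%:R <= h.
  exists (Num.Def.archi_bound (L / h)).+1 => //.
  rewrite ler_pdivrMr ?ltr0n // mulrC -ler_pdivrMr //.
  apply/ltW/(lt_trans (archi_boundP _)); first by rewrite divr_ge0 // ltW.
  by rewrite ltr_nat.
have DR0 : 0 < D%:R :> R by rewrite ltr0n.
have BR0 : 0 < B%:R :> R by rewrite ltr0n.
pose w : R := B%:R * (3 * h).
pose v : R := (2 * w) * D%:R^-1 ^+ n.
have w0 : 0 <= w by rewrite !mulr_ge0 // ltW.
have v0 : 0 <= v.
  apply: mulr_ge0; first exact: mulr_ge0.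
  by apply: exprn_ge0; rewrite invr_ge0 ltW.
(* The cells reach up to [1 + B], beyond the needed [B], so that the truncated index stays strictly
   below [B * D] even at [q i = B]. *)
pose cell (t : {ffun 'I_n -> 'I_(B * D)}) (q : 'I_n.+1 -> R) :=
  forall i, 1 + (t i)%:R / D%:R <= q (lift j i) <= 1 + (t i).+1%:R / D%:R.
have cov t : covered (S `&` cell t) v.
  have [[q0 [[q01 q0h] q0t]]|empty] := pselect (exists q, (S `&` cell t) q); last first.
    by apply: covered_sub v0 (covered_set0 R n) => q qS; case: empty; exists q.
  (* Coordinates other than [j] are confined by the cell, coordinate [j] by
     its distance to a fixed point of the slab in the same cell. *)
  pose a i := if unlift j i is Some i' then 1 + (t i')%:R / D%:R else q0 j - w.
  pose b i := if unlift j i is Some i' then 1 + (t i').+1%:R / D%:R else q0 j + w.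
  have ab i : a i <= b i.
    rewrite /a /b; case: unliftP => [i' _|_]; last lra.
    by rewrite lerD2l ler_pM2r ?invr_gt0 // ler_nat.
  apply: covered_sub (covered_box a b ab); last first.
    rewrite (bigD1_ord j) //= /a /b unlift_none.
    rewrite (eq_bigr (fun=> D%:R^-1)) => [|i _].
      by rewrite prodr_const card_ord /v le_eqVlt; apply/orP; left; apply/eqP; ring.
    by rewrite liftK -natr1 mulrDl mul1r; ring.
  move=> q [[q1 qh] qt] i /=; rewrite /a /b.
  case: unliftP => [i' ->|->]; first exact: qt.
  have q_ge1 k : 1 <= q k by case/andP: (q1 k).
  have q0_ge1 k : 1 <= q0 k by case/andP: (q01 k).
  have close k : k != j -> `|q k - q0 k| <= D%:R^-1.
    case: (unliftP j k) => [k' ->|->]; last by rewrite eqxx.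
    move=> _; have := qt k'; have := q0t k'.
    rewrite -natr1 mulrDl mul1r ler_distl => /andP[? ?] /andP[? ?].
    by apply/andP; split; lra.
  have Di0 : 0 <= D%:R^-1 :> R by rewrite invr_ge0 ltW.
  have := bval_coord_dist_le q q0 j m m' f f' h _ m0 m'0 fj q_ge1 q0_ge1 qh q0h Di0 close.
  rewrite -/L => lnq.
  have : `|q j - q0 j| <= w.
    apply: le_trans (dist_le_ln B%:R _ _ _ _) _.
    - by have /andP[? ->] := q1 j; rewrite andbT; lra.
    - by have /andP[? ->] := q01 j; rewrite andbT; lra.
    - rewrite /w ler_pM2l //; lra.
  by rewrite ler_distl.
apply: covered_sub (covered_finType _ v v0 cov).
- move=> q [q1 qh].
  have c_lt i : (Num.truncn ((q (lift j i) - 1) * D%:R) < B * D)%N.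
    have /andP[q1i qB] := q1 (lift j i).
    rewrite truncn_lt_nat ?mulr_ge0 ?subr_ge0 ?ler0n // natrM ltr_pM2r //; lra.
  exists [ffun i => Ordinal (c_lt i)] => //; split=> // i; rewrite ffunE /=.
  have /andP[q1i qB] := q1 (lift j i).
  have /andP[lo hi] : (Num.truncn ((q (lift j i) - 1) * D%:R))%:R <=
      (q (lift j i) - 1) * D%:R <
      (Num.truncn ((q (lift j i) - 1) * D%:R)).+1%:R.
    by apply: truncn_itv; rewrite mulr_ge0 ?subr_ge0.
  apply/andP; split; first by rewrite -lerBrDl ler_pdivrMr.
  by rewrite -lerBlDl ler_pdivlMr // ltW.
- rewrite card_ffun !card_ord -[v *+ _]mulr_natr natrX natrM exprMn /v /w exprVn exprS.
  rewrite le_eqVlt; apply/orP; left; apply/eqP; field.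
  by rewrite expf_neq0 // gt_eqF.
Qed.

(** * Almost every point is well spaced *)

(** Dyadic bounds leave countably many scales to treat. Since [c > 0], the inequality also forbids
    exact coincidences with [f j != f' j]. *)
Definition well_spaced {R : realType} {N : nat} (q : 'I_N -> R) : Prop :=
  exists (c : R) (C : nat), 0 < c /\
    forall (i m m' : nat) (f f' : 'I_N -> nat) (j : 'I_N),
      (0 < m)%N -> (0 < m')%N -> f j != f' j ->
      bval q m f <= 2 ^+ i -> bval q m' f' <= 2 ^+ i ->
      c <= `|bval q m f - bval q m' f'| * (2 ^+ i) ^+ C.

Lemma bernoulli_le {R : realDomainType} (d : R) (n : nat) :
  0 <= d -> 1 + d *+ n <= (1 + d) ^+ n.
Proof.
move=> d0; elim: n => [|n ih]; first by rewrite mulr0n addr0.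
rewrite exprS; apply: (@le_trans _ _ ((1 + d) * (1 + d *+ n))).
  have : 0 <= d * (d *+ n) by rewrite mulr_ge0 ?mulrn_wge0.
  rewrite mulrS; nra.
by rewrite ler_wpM2l // addr_ge0.
Qed.

(** Bernoulli's inequality gives [1 + f j / k.+1 <= q j ^+ f j], so the exponents are at most linear
    in [X]. This is crude, but it keeps the number of pairs polynomial. *)
Lemma bval_le_bounds {R : realType} {N : nat} (q : 'I_N -> R) (k m X : nat)
    (f : 'I_N -> nat) :
  (forall j, 1 + k.+1%:R^-1 <= q j) -> (0 < m)%N -> bval q m f <= X%:R ->
  (m <= X)%N /\ forall j, (f j <= k.+1 * X)%N.
Proof.
move=> kq m0 fX.
have q1 j : 1 <= q j by apply: le_trans (kq j); rewrite lerDl invr_ge0.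
have qf1 (P : pred 'I_N) : 1 <= \prod_(i | P i) q i ^+ f i.
  by elim/big_ind: _ => // [x y x1 y1|j _]; rewrite ?exprn_ege1 // mulr_ege1.
split=> [|j].
  rewrite -(ler_nat R); apply: le_trans fX.
  by rewrite ler_peMr ?ler0n //; exact: (qf1 xpredT).
rewrite -(ler_nat R) natrM -ler_pdivrMl ?ltr0n //.
have -> : k.+1%:R^-1 * (f j)%:R = k.+1%:R^-1 *+ f j :> R by rewrite mulr_natr.
apply: le_trans fX.
apply: (@le_trans _ _ (q j ^+ f j)).
  apply: (@le_trans _ _ ((1 + k.+1%:R^-1) ^+ f j)).
    apply: le_trans (bernoulli_le _ _ _); last by rewrite invr_ge0.
    by rewrite lerDr.
  by rewrite lerXn2r ?nnegrE ?addr_ge0 ?invr_ge0 //; apply: le_trans (q1 j).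
rewrite /bval (bigD1 j) //= mulrCA ler_peMr //.
  by rewrite exprn_ge0 //; apply: le_trans (q1 j).
by rewrite mulr_ege1 ?ler1n.
Qed.

(** Two nested countable unions share out [eps]: first over domains exhausting the points with all
    [q j > 1], then, on a fixed domain, over the scales [2 ^+ i]. The constant [c] may depend on the
    domain and on [eps]. *)
Lemma null_not_well_spaced {R : realType} {n : nat} :
  lebesgue_null
    [set q : 'I_n.+1 -> R | (forall j, 1 < q j) /\ ~ well_spaced q].
Proof.
move=> eps eps0; set N := n.+1.
pose dom (k : nat) := [set q : 'I_N -> R |
  forall j, 1 + k.+1%:R^-1 <= q j <= k.+2%:R].
suff dom_cov k : covered (dom k `&` [set q | ~ well_spaced q]) (eps / 2 ^+ k.+1).
  have [a [b [? abE ?]]] := covered_seq _ _ (ltW eps0) dom_cov.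
  exists a, b; split=> //; split=> // q [q1 nq]; apply: abE.
  (* The first entry keeps [q j] away from 1, the second bounds it above. *)
  pose K j := maxn (Num.truncn ((q j - 1)^-1)) (Num.truncn (q j)).
  exists (\max_j K j) => //; split=> //= j.
  have : (K j <= \max_j K j)%N by exact: leq_bigmax.
  rewrite geq_max => /andP[].
  have qj0 : 0 < q j - 1 by rewrite subr_gt0.
  have q0 : 0 <= q j by have := q1 j; lra.
  rewrite -ltnS truncn_lt_nat ?invr_ge0 ?(ltW qj0) // => h1.
  rewrite -ltnS truncn_lt_nat // => h2.
  apply/andP; split.
    rewrite -lerBrDl -[leRHS]invrK lef_pV2 ?posrE ?ltr0n ?invr_gt0 //.
    exact: ltW.
  by rewrite (le_trans (ltW h2)) // ler_nat.
set e := eps / _; have e0 : 0 < e by rewrite divr_gt0 ?exprn_gt0.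
(* There are at most [4 * X ^ 2 * (k.+2 * X) ^ (2 * N) * N] tuples, each costing [6 * h * k.+2 ^ N];
   this explains [A]. The exponent exceeds the count's [2 * N + 2] by one, leaving
   [A * c / X = e / 2 ^+ i.+1]. *)
pose C := (2 * N + 3)%N.
pose A : R := 24 * k.+2%:R ^+ (3 * N) * N%:R.
have A0 : 0 < A by rewrite !mulr_gt0 ?exprn_gt0 ?ltr0n.
pose c : R := e / (2 * A).
have c0 : 0 < c by rewrite divr_gt0 ?mulr_gt0.
pose bad (i : nat) := [set q : 'I_N -> R |
  exists (m m' : nat) (f f' : 'I_N -> nat) (j : 'I_N),
  [/\ (0 < m)%N, (0 < m')%N, f j != f' j, bval q m f <= 2 ^+ i &
      bval q m' f' <= 2 ^+ i] /\
  `|bval q m f - bval q m' f'| <= c / (2 ^+ i) ^+ C].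
suff bad_cov i : covered (dom k `&` bad i) (e / 2 ^+ i.+1).
  apply: covered_sub (lexx _) (covered_seq _ _ (ltW e0) bad_cov) => q [qk nq].
  apply: contrapT => nbad; apply: nq; exists c, C; split=> //.
  move=> i m m' f f' j m0 m'0 fj fi f'i.
  rewrite leNgt; apply/negP => lt_c; apply: nbad; exists i => //; split=> //.
  exists m, m', f, f', j; split=> //.
  by rewrite ler_pdivlMr ?exprn_gt0 // ltW.
pose X := (2 ^ i)%N; pose L := (k.+1 * X)%N.
have X0 : (0 < X)%N by rewrite expn_gt0.
have XE : 2 ^+ i = X%:R :> R by rewrite natrX.
rewrite /bad XE.
pose h : R := c / X%:R ^+ C.
have XR0 : 0 < X%:R :> R by rewrite ltr0n.
have h0 : 0 < h by rewrite divr_gt0 ?exprn_gt0.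
(* All tuples allowed by [bval_le_bounds]. The inadmissible ones, such as [m = 0], are kept in [T]
   and give empty sets [F t]. *)
pose T : finType :=
  ('I_X.+1 * 'I_X.+1 * {ffun 'I_N -> 'I_L.+1} * {ffun 'I_N -> 'I_L.+1} * 'I_N)%type.
pose F (t : T) := [set q : 'I_N -> R |
  let: (m, m', f, f', j) := t in
  [/\ (0 < m)%N, (0 < m')%N & f j != f' j :> nat] /\
  (forall i, 1 <= q i <= k.+2%:R) /\
  `|bval q m (fun i => f i) - bval q m' (fun i => f' i)| <= h].
pose v : R := 6 * h * k.+2%:R ^+ N.
have v0 : 0 <= v.
  by apply: mulr_ge0; [rewrite mulr_ge0 // ltW | exact: exprn_ge0].
have F_cov t : covered (F t) v.
  case: t => [[[[m m'] f] f'] j].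
  have [[m0 m'0 fj]|no] := pselect ([/\ (0 < m)%N, (0 < m')%N & f j != f' j :> nat]).
    apply: covered_sub (lexx _) (covered_slab k.+2 h j m m'
      (fun i => f i) (fun i => f' i) _ h0 m0 m'0 fj) => // q [_ []] //.
  by apply: covered_sub v0 (covered_set0 R n) => q [].
apply: covered_sub (covered_finType _ v v0 F_cov).
- move=> q [qk [m [m' [f [f' [j [[m0 m'0 fj fX f'X] near]]]]]]].
  have kq i0 : 1 + k.+1%:R^-1 <= q i0 by case/andP: (qk i0).
  have [mX fL] := bval_le_bounds _ _ _ _ _ kq m0 fX.
  have [m'X f'L] := bval_le_bounds _ _ _ _ _ kq m'0 f'X.
  exists (inord m, inord m', [ffun i => inord (f i)], [ffun i => inord (f' i)], j) => //.
  rewrite /F /= !ffunE !inordK ?ltnS //; split=> //; split.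
    move=> i0; have /andP[? ->] := qk i0; rewrite andbT.
    by apply: le_trans (kq i0); rewrite lerDl invr_ge0.
  rewrite (_ : (fun i0 => _) = f); last first.
    by apply/funext => i0; rewrite ffunE inordK ?ltnS.
  rewrite (_ : (fun i0 => nat_of_ord ([ffun i => inord (f' i)] i0)) = f') //.
  by apply/funext => i0; rewrite ffunE inordK ?ltnS.
- rewrite !card_prod !card_ffun !card_ord -[v *+ _]mulr_natr !natrM !natrX.
  have X1 : X.+1%:R <= 2 * X%:R :> R by rewrite -natrM ler_nat; lia.
  have L1 : L.+1%:R <= k.+2%:R * X%:R :> R.
    by rewrite -natrM ler_nat /L; nia.
  apply: (@le_trans _ _ (v * ((2 * X%:R) * (2 * X%:R) *
      (k.+2%:R * X%:R) ^+ N * (k.+2%:R * X%:R) ^+ N * N%:R))).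
    rewrite ler_wpM2l // ler_wpM2r // !ler_pM ?mulr_ge0 ?exprn_ge0 //.
    1,2: by rewrite lerXn2r ?nnegrE.
  rewrite le_eqVlt; apply/orP; left; apply/eqP.
  (* With [N] symbolic, the powers are regrouped around [X ^+ N] and [k.+2 ^+ N], which are then
     generalized to atoms for [field]. *)
  have -> : v = 6 * (e / (2 * (24 * (k.+2%:R ^+ N) ^+ 3 * N%:R)) /
      ((X%:R ^+ N) ^+ 2 * X%:R ^+ 3)) * k.+2%:R ^+ N.
    by rewrite -!exprM -exprD (mulnC N 2) (mulnC N 3).
  rewrite [2 ^+ i.+1]exprS XE exprMn.
  have PN0 : k.+2%:R ^+ N != 0 :> R by rewrite expf_neq0 // pnatr_eq0.
  have QN0 : X%:R ^+ N != 0 :> R by rewrite expf_neq0 // gt_eqF.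
  have NN0 : N%:R != 0 :> R by rewrite pnatr_eq0.
  have Y0 : X%:R != 0 :> R by rewrite gt_eqF.
  move: (X%:R) (N%:R) (X%:R ^+ N) (k.+2%:R ^+ N) PN0 QN0 NN0 Y0
    => Y M Q P P0 Q0 M0 Y0.
  by field; rewrite P0 Q0 M0 Y0.
Qed.

(** * Unique factorization and linear independence *)

(** Products of ordinary primes are exactly the positive integers, so one number [m] replaces the
    exponent vector; conversely, the exponents are [logn p m] and primes up to [m] suffice. *)
Lemma beurling_intP {R : realType} {N : nat} (q : 'I_N -> R) (x : R) :
  beurling_int q x <->
  exists (m : nat) (f : 'I_N -> nat), (0 < m)%N /\ x = bval q m f.
Proof.
split=> [[M [e [f ->]]]|[m [f [m0 ->]]]].
  exists (\prod_(p < M | prime p) p ^ e p)%N, f; split.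
    by rewrite prodn_cond_gt0 // => p pp; rewrite expn_gt0 prime_gt0.
  rewrite /bval natr_prod; congr (_ * _).
  by apply: eq_bigr => p _; rewrite natrX.
exists m.+1, (logn^~ m), f; rewrite /bval; congr (_ * _).
rewrite -[in LHS](partnT m0) (widen_partn _ (leqnn m)) big_mkord natr_prod.
rewrite [LHS]big_mkcond [RHS]big_mkcond /=; apply: eq_bigr => p _.
by case: ifP => pp; rewrite natrX // lognE pp expr0.
Qed.

(** Clearing denominators and separating positive from negative parts turns a rational relation into
    an equality between two products with natural exponents. *)
Lemma rat_common_denom {I : finType} (a : I -> rat) :
  exists (d : nat) (u v : I -> nat), (0 < d)%N /\
    forall i, a i * d%:R = (u i)%:R - (v i)%:R.
Proof.
pose d := (\prod_i `|denq (a i)|)%N.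
pose z i : int := numq (a i) * (\prod_(k | k != i) `|denq (a k)|)%N.
exists d, (fun i => if z i is Posz n then n else 0%N),
  (fun i => if z i is Negz n then n.+1 else 0%N); split.
  by rewrite prodn_gt0 // => i; rewrite absz_gt0 denq_neq0.
move=> i; have -> : a i * d%:R = (z i)%:~R.
  rewrite /d (bigD1 i) //= natrM /z rmorphM /= mulrA; congr (_ * _).
  rewrite -[X in X * _]divq_num_den pmulrn absz_denq divfK //.
  by rewrite intr_eq0 denq_neq0.
by case: (z i) => k; rewrite ?subr0 // NegzE sub0r mulrNz.
Qed.

Lemma logn_prod_primes (M : nat) (e : nat -> nat) (r : nat) :
  (r < M)%N -> prime r -> logn r (\prod_(p < M | prime p) p ^ e p) = e r.
Proof.
move=> rM pr.
rewrite (bigD1 (Ordinal rM)) //=; set P := (\prod_(_ < M | _) _)%N.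
suff /andP[P0 /eqP P_r] : (0 < P)%N && (logn r P == 0%N).
  have re0 : (0 < r ^ e r)%N by rewrite expn_gt0 prime_gt0.
  by rewrite (lognM r re0 P0) P_r addn0 lognX logn_prime // eqxx muln1.
apply: (big_ind (fun x => (0 < x)%N && (logn r x == 0%N))); first by rewrite logn1.
  by move=> x y /andP[x0 /eqP xr] /andP[y0 /eqP yr]; rewrite muln_gt0 x0 y0 lognM // xr yr.
move=> p /andP[pp pr']; rewrite expn_gt0 prime_gt0 //= lognX logn_prime //.
by move: pr'; rewrite -val_eqE /= eq_sym => /negPf->; rewrite muln0.
Qed.

(** The least such [i] works: its predecessor gives a power below [x], and [1 <= x] settles [i = 0].
    The upper bound later turns powers of [2 ^+ i] into powers of [x]. *)
Lemma exists_pow2_ge {R : realType} (x : R) :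
  1 <= x -> exists i : nat, x <= 2 ^+ i <= 2 * x.
Proof.
move=> x1; have x0 : 0 <= x by lra.
have ex : exists i : nat, x <= 2 ^+ i.
  exists (Num.truncn x).+1; have /andP[_ /ltW xt] := truncn_itv x0.
  by rewrite (le_trans xt) // -natrX ler_nat ltnW // ltn_expl.
case: (ex_minnP ex) => -[|i] xi mi.
  by exists 0%N; rewrite xi expr0; lra.
exists i.+1; rewrite xi exprS ler_pM2l //= leNgt; apply/negP => /ltW /mi.
by rewrite ltnn.
Qed.

Lemma well_spaced_lin_indep {R : realType} {N : nat} (q : 'I_N -> R) :
  (forall j, 1 < q j) -> well_spaced q -> lin_indep_logs q.
Proof.
move=> q1 [c [C [c0 sp]]] M a b ab0.
have q0 j : 0 < q j by apply: lt_trans (q1 j).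
(* One family over the disjoint sum, so that a single [d] clears both kinds of coefficients. *)
pose ab (i : 'I_M + 'I_N) := match i with inl p => a p | inr j => b j end.
have [d [u [v [d0 uv]]]] := rat_common_denom ab.
pose e (w : 'I_M + 'I_N -> nat) (p : nat) :=
  if insub p is Some i then w (inl i) else 0%N.
have eE w (p : 'I_M) : e w p = w (inl p) by rewrite /e valK.
pose m (w : 'I_M + 'I_N -> nat) := (\prod_(p < M | prime p) p ^ e w p)%N.
pose f (w : 'I_M + 'I_N -> nat) (j : 'I_N) := w (inr j).
have m0 w : (0 < m w)%N.
  by rewrite prodn_cond_gt0 // => p pp; rewrite expn_gt0 prime_gt0.
have b0 w : 0 < bval q (m w) (f w).
  apply: lt_le_trans (bval_ge1 _ _ _ _ (m0 w)) => // j; exact: ltW.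
have lnm w : ln (m w)%:R =
    \sum_(p < M | prime p) (w (inl p))%:R * ln (p%:R : R).
  rewrite natr_prod ln_prod => [|p pp]; last by rewrite ltr0n expn_gt0 prime_gt0.
  apply: eq_bigr => p pp.
  by rewrite natrX lnXn ?ltr0n ?prime_gt0 // eE mulr_natl.
have uvR i : ratr (ab i) * d%:R = (u i)%:R - (v i)%:R :> R.
  by have := congr1 (@ratr R) (uv i); rewrite rmorphM rmorphB /= !ratr_nat.
have lnE : ln (bval q (m u) (f u)) = ln (bval q (m v) (f v)).
  apply/eqP; rewrite -subr_eq0 !ln_bval // !lnm opprD addrACA -!sumrB.
  apply/eqP; have := congr1 ( *%R^~ d%:R) ab0; rewrite /= mul0r; apply: etrans.
  rewrite mulrDl !mulr_suml; congr (_ + _); apply: eq_bigr => i _; rewrite -mulrBl -uvR /=; ring.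
have valE : bval q (m u) (f u) = bval q (m v) (f v).
  by apply: ln_inj lnE; rewrite posrE.
have fE j : f u j = f v j.
  apply/eqP; apply/negPn/negP => fj.
  have [|i /andP[hi _]] := exists_pow2_ge (bval q (m u) (f u)).
    by apply: bval_ge1 => // j'; exact: ltW.
  (* The two values coincide, so distinct exponents would force [c <= 0]. *)
  have := sp i _ _ _ _ j (m0 u) (m0 v) fj hi.
  rewrite -valE => /(_ hi).
  by rewrite subrr normr0 mul0r leNgt c0.
have mE : m u = m v.
  move: valE; rewrite /bval (eq_bigr (fun j => q j ^+ f v j)) => [|j _]; last by rewrite fE.
  move/mulIf => /(_ _)/eqP; rewrite eqr_nat => /(_ _)/eqP; apply.
  by rewrite gt_eqF // prodr_gt0 // => j _; rewrite exprn_gt0.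
have zero i : u i = v i -> ab i = 0.
  move=> uvi; have /eqP := uv i; rewrite uvi subrr mulf_eq0 pnatr_eq0.
  by rewrite (gtn_eqF d0) orbF => /eqP.
split=> [p pM pp|j]; last exact: (zero (inr j) (fE j)).
apply: (zero (inl (Ordinal pM))).
rewrite -(eE u (Ordinal pM)) -(eE v (Ordinal pM)) /=.
by rewrite -(logn_prod_primes _ (e u) _ pM pp) -(logn_prod_primes _ (e v) _ pM pp) -/(m u) mE.
Qed.

(** * Increasing enumeration and Bohr's condition *)

(** Local separation gives each real a next element of [A]. Iterating from the minimum, the terms
    grow by at least a fixed [d] while they stay below a given [x], so they pass [x] and cannot skip
    it. *)
Lemma enum_locally_separated {R : realType} (A : set R) (x0 : R) :
  A x0 -> (forall x, A x -> x0 <= x) ->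
  (forall M, exists2 x, A x & M < x) ->
  (forall M, exists2 d, 0 < d &
     forall x y, A x -> A y -> y < x -> x <= M -> d <= x - y) ->
  exists nu : nat -> R, (forall n, nu n < nu n.+1) /\
    (forall x, A x <-> exists n, nu n = x).
Proof.
move=> Ax0 A_ge A_unbd A_sep.
have succ t : exists y, [/\ A y, t < y & forall z, A z -> t < z -> y <= z].
  have [x Ax tx] := A_unbd t; have [d d0 dP] := A_sep x.
  pose E := [set z | A z /\ t < z].
  have lbE : has_lbound E by exists t => z [_ /ltW].
  have [|z [Az tz] zE] := @inf_adherent _ E d d0.
    by split; first by exists x.
  (* An element within [d] of the infimum is the minimum, since a smaller one would be closer than
     [d]. The cap [w <= x] is there because [d] separates only elements up to [x]. *)
  have [w [Aw tw wx wE]] : exists w, [/\ A w, t < w, w <= x & w < inf E + d].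
    case: (leP z x) => [zx|xz]; first by exists z.
    by exists x; split=> //; apply: lt_trans zE.
  exists w; split=> // z' Az' tz'; rewrite leNgt; apply/negP => z'w.
  have := dP _ _ Aw Az' z'w wx; have := ge_inf lbE (conj Az' tz') : inf E <= z'.
  lra.
have [next nextP] := choice succ.
pose nu n := iter n next x0.
have nu_lt n : nu n < nu n.+1 by case: (nextP (nu n)).
have nuA n : A (nu n) by case: n => // n; case: (nextP (nu n)).
exists nu; split=> // x; split=> [Ax|[n <-]//].
have [d d0 dP] := A_sep x.
have grow n : nu n <= x -> x0 + n%:R * d <= nu n.
  elim: n => [_|n ih nx]; first by rewrite mul0r addr0.
  have := dP _ _ (nuA n.+1) (nuA n) (nu_lt n) nx.
  by have := ih (le_trans (ltW (nu_lt n)) nx); rewrite -natr1 mulrDl; lra.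
have ex : exists n, x < nu n.
  apply: contrapT => no.
  have := grow (Num.truncn ((x - x0) / d)).+1.
  have xd0 : 0 <= (x - x0) / d by rewrite divr_ge0 ?subr_ge0 ?A_ge // ltW.
  have /andP[_] := truncn_itv xd0; rewrite ltr_pdivrMr // => h.
  have nux n : nu n <= x by rewrite leNgt; apply/negP => xn; apply: no; exists n.
  by move=> /(_ (nux _)); have := nux (Num.truncn ((x - x0) / d)).+1; lra.
(* At the first index past [x], the preceding term is at most [x] by minimality; were it smaller,
   its successor would be at most [x] too. *)
case: (ex_minnP ex) => -[|n] xn minn; first by have := A_ge x Ax; rewrite leNgt xn.
exists n; apply/eqP; rewrite eq_le.
apply/andP; split; rewrite leNgt; apply/negP => nx.
  by have := minn n nx; rewrite ltnn.
by have [_ _ /(_ x Ax nx)] := nextP (nu n); rewrite leNgt xn.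
Qed.

Lemma well_spaced_bohr {R : realType} {N : nat} (q : 'I_N -> R) :
  (forall j, 1 < q j) -> well_spaced q -> bohr_condition q.
Proof.
move=> q1 [c [C [c0 sp]]].
have q1' j : 1 <= q j by exact: ltW.
(* The 1 serves pairs with equal exponents, whose gap is a positive integer times a product at least
   1; [c] serves the others. *)
pose c' := Num.min 1 c.
have c'0 : 0 < c' by rewrite lt_min ltr01.
pose A : set R := [set x | beurling_int q x].
have A_ge x : A x -> 1 <= x.
  by move=> /beurling_intP[m [f [m0 ->]]]; exact: bval_ge1.
have gap (i : nat) x y : A x -> A y -> y < x -> x <= 2 ^+ i ->
    c' <= (x - y) * (2 ^+ i) ^+ C.
  move=> /beurling_intP[m [f [m0 ->]]] /beurling_intP[m' [f' [m'0 ->]]] yx xi.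
  have [[j fj]|ff] := pselect (exists j, f j != f' j); last first.
    have ff' : f' = f.
      apply/funext => j; apply/esym/eqP/negPn/negP => fj; by apply: ff; exists j.
    rewrite ff' in yx *.
    have p1 : 1 <= \prod_j q j ^+ f j.
      by have := bval_ge1 q 1 f q1' isT; rewrite /bval mul1r.
    have mm' : (m' < m)%N.
      by move: yx; rewrite /bval ltr_pM2r ?ltr_nat //; apply: lt_le_trans p1.
    rewrite ge_min; apply/orP; left.
    rewrite mulr_ege1 //; last by rewrite !exprn_ege1 // ler1n.
    rewrite /bval -mulrBl mulr_ege1 //.
    by move: mm'; rewrite -(ler_nat R) -natr1; lra.
  rewrite ge_min; apply/orP; right.
  have := sp i m m' f f' _ m0 m'0 fj xi (le_trans (ltW yx) xi).
  by rewrite ger0_norm // subr_ge0 ltW.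
have nat_A m : (0 < m)%N -> A m%:R.
  move=> m0; apply/beurling_intP; exists m, (fun=> 0%N); split=> //.
  by rewrite /bval big1 ?mulr1 // => j _; rewrite expr0.
have A_unbd M : exists2 x, A x & M < x.
  exists (Num.Def.archi_bound `|M|).+1%:R; first exact: nat_A.
  rewrite (le_lt_trans (ler_norm M)) // (lt_trans (archi_boundP _)) //.
  by rewrite ltr_nat.
have A_sep M : exists2 d, 0 < d &
    forall x y, A x -> A y -> y < x -> x <= M -> d <= x - y.
  have [|i /andP[Mi _]] := exists_pow2_ge (Num.max 1 M); first by rewrite le_max lexx.
  exists (c' / (2 ^+ i) ^+ C) => [|x y Ax Ay yx xM].
    by rewrite divr_gt0 ?exprn_gt0.
  rewrite ler_pdivrMr ?exprn_gt0 //; apply: gap => //.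
  by apply: le_trans Mi; rewrite le_max xM orbT.
have [nu [nu_lt nuP]] := enum_locally_separated A 1 (nat_A 1%N isT) A_ge A_unbd A_sep.
(* Using [C.+1] makes the exponent positive even if [C = 0], at the price of a factor [2 * x >= 1];
   the power of 2 in [c1] comes from [2 ^+ i <= 2 * x]. *)
exists (c' / 2 ^+ C.+1), C.+1%:R; split; first by rewrite divr_gt0 ?exprn_gt0.
split=> //; exists nu; split=> //; split=> // n.
have nuA k : A (nu k) by apply/nuP; exists k.
set x := nu n.+1; have x1 : 1 <= x by exact: A_ge (nuA _).
have [i /andP[xi ix]] := exists_pow2_ge x x1.
have x0 : 0 < x by lra.
have -> : c' / 2 ^+ C.+1 * x `^ (- C.+1%:R) = c' / (2 * x) ^+ C.+1.
  by rewrite powRN powR_mulrn ?ltW // exprMn invfM mulrA.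
rewrite ler_pdivrMr ?exprn_gt0 ?mulr_gt0 //.
apply: le_trans (gap i _ _ (nuA n.+1) (nuA n) (nu_lt n) xi) _.
rewrite ler_wpM2l ?subr_ge0 ?(ltW (nu_lt n)) //.
apply: (@le_trans _ _ ((2 * x) ^+ C)).
  by rewrite lerXn2r ?nnegrE ?exprn_ge0 ?mulr_ge0 ?(ltW x0).
by rewrite exprS ler_peMl ?exprn_ge0 ?mulr_ge0 //; lra.
Qed.

Theorem theorem1p1 (R : realType) (N : nat) (hN : (1 <= N)%N) :
  lebesgue_null
    [set q : 'I_N -> R | (forall j, 1 < q j) /\
                         ~ (beurling_system q /\ bohr_condition q)].
Proof.
(* The box covers were built in dimension [n.+1], where padding boxes have volume 0. *)
case: N hN => // n _ eps eps0.
have [a [b [ab [cov vol]]]] := @null_not_well_spaced R n eps eps0.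
exists a, b; split=> //; split=> // q [q1 bad]; apply: cov; split=> // ws.
apply: bad; split; last exact: well_spaced_bohr.
by split=> //; exact: well_spaced_lin_indep.
Qed.
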